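(* Let $X$ be a Hausdorff space and $A,B\subseteq X$. (a) $A\subseteq c(A)$. (b) If $A\subseteq B$ then $c(A)\subseteq c(B)$. (c) $cl\,A\subseteq c(A)\subseteq cl_\theta(A)$. (d) If $U\subseteq X$ is open, then $cl\,U=c(U)\subseteq c(\widehat{U})$. (e) If $X$ is regular then $cl\,A=c(A)=cl_\theta(A)$. (f) If $A$ is $c$-closed then $A$ is closed.
   Context: An open ultrafilter on a Hausdorff space $X$ is a maximal filter in the family of open subsets of $X$ (its members are nonempty open sets); it converges to $x\in X$ if it contains every open set containing $x$. $EX$ is the set of all convergent open ultrafilters on $X$. A section is a function $b:X\to EX$ such that $b(x)$ converges to $x$ for every $x\in X$. For a section $b$ and an open set $U$ let $\widehat{U}_b=\{x\in X: U\in b(x)\}$, and for $A\subseteq X$ let $c_b(A)=\{x\in X:\widehat{U}_b\cap A\neq\varnothing\text{ for every open }U\ni x\}$. $A$ is $c_b$-closed if $c_b(A)=A$. For $A\subseteq X$, $aL(A,X)$ is the least infinite cardinal $\kappa$ such that every cover $\mathcal V$ of $A$ by open sets of $X$ has a subfamily $\mathcal W$ with $|\mathcal W|\leq\kappa$ and $A\subseteq\bigcup_{W\in\mathcal W}cl\,W$. Put $aL^b(X)=\sup\{aL(C,X): C\text{ is }c_b\text{-closed}\}+\aleph_0$ and $aL'(X)=\min\{aL^b(X): b\text{ a section}\}$. Fix any section $b'$ with $aL^{b'}(X)=aL'(X)$ and write $\widehat{U}=\widehat{U}_{b'}$, $c=c_{b'}$; $A$ is $c$-closed if $c(A)=A$.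 The $\theta$-closure is $cl_\theta(A)=\{x\in X: cl(U)\cap A\neq\varnothing\text{ for every open }U\ni x\}$. *)

(* Defs.v *)
From mathcomp Require Import all_boot all_order.
From mathcomp Require Import boolp classical_sets functions cardinality topology.

Set Implicit Arguments.
Unset Strict Implicit.
Unset Printing Implicit Defensive.

Local Open Scope classical_set_scope.
Local Open Scope card_scope.

Section OpenUltrafilters.
Context {X : topologicalType}.
Implicit Types (p : set (set X)) (A U : set X).

(* A filter in the family of open sets: unlike the library's Filter, it
   contains only open sets and is upward closed only among open sets. *)
Definition open_filter p : Prop :=
  [/\ p setT,
      forall U, p U -> open U /\ U !=set0,
      forall U V, p U -> p V -> p (U `&` V)
    & forall U V, p U -> open V -> U `<=` V -> p V].

Definition open_ultrafilter p : Prop :=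
  open_filter p /\ forall q, open_filter q -> p `<=` q -> q = p.

Definition converges_to p (x : X) : Prop :=
  forall U, open U -> U x -> p U.

Definition EX : Type :=
  {p : set (set X) | open_ultrafilter p /\ exists x, converges_to p x}.

Definition is_section (b : X -> EX) : Prop :=
  forall x, converges_to (sval (b x)) x.

Definition hat (b : X -> EX) U : set X := [set x | sval (b x) U].

Definition cb (b : X -> EX) A : set X :=
  [set x | forall U, open U -> U x -> hat b U `&` A !=set0].

Definition cb_closed (b : X -> EX) A : Prop := cb b A = A.

Definition cl_theta A : set X :=
  [set x | forall U, open U -> U x -> closure U `&` A !=set0].

End OpenUltrafilters.

Arguments EX X : clear implicits.

(* A cardinal is represented by any type K of that cardinality, so the cardinal
   invariants below are predicates on types, each determining K up to a
   bijection. *)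

Definition card_min (P : Type -> Prop) (K : Type) : Prop :=
  P K /\ forall L : Type, P L -> [set: K] #<= [set: L].

Definition card_sup (P : Type -> Prop) : Type -> Prop :=
  card_min (fun K : Type => forall L : Type, P L -> [set: L] #<= [set: K]).

Section Invariants.
Context {X : topologicalType}.

(* is_aL A K: the cardinality of K is aL(A, X). *)
Definition is_aL (A : set X) : Type -> Prop :=
  card_min (fun K : Type =>
    infinite_set [set: K] /\
    forall V : set (set X), V `<=` open -> A `<=` \bigcup_(U in V) U ->
      exists W : set (set X),
        [/\ W `<=` V, W #<= [set: K] & A `<=` \bigcup_(U in W) closure U]).

(* is_aLb b K: the cardinality of K is aL^b(X); S + nat is the cardinal sum of
   the supremum S and aleph_0. *)
Definition is_aLb (b : X -> EX X) (K : Type) : Prop :=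
  exists S : Type,
    card_sup (fun L : Type => exists C : set X, cb_closed b C /\ is_aL C L) S
    /\ [set: K] #= [set: (S + nat)%type].

End Invariants.

(* is_aL' X K: the cardinality of K is aL'(X). *)
Definition is_aL' (X : topologicalType) : Type -> Prop :=
  card_min (fun K : Type => exists b : X -> EX X, is_section b /\ is_aLb b K).

(* Main.v *)
(* Everything rests on U <= hat U <= closure U for open U: the points of U have
   U in their ultrafilter by convergence, and if U is in the ultrafilter at y
   then U meets every open neighbourhood of y, since both belong to a filter of
   nonempty open sets. *)

Require Import Defs.
From mathcomp Require Import all_boot all_order.
From mathcomp Require Import boolp classical_sets functions cardinality topology.

Local Open Scope classical_set_scope.

Section CbClosure.
Variables (X : topologicalType) (b : X -> EX X).
Hypothesis hb : is_section b.
Implicit Types A B U : set X.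

Lemma sub_hat U : open U -> U `<=` hat b U.
Proof. by move=> oU x Ux; exact: hb. Qed.

Lemma hat_sub_closure U : hat b U `<=` closure U.
Proof.
move=> y Uy B; rewrite nbhsE => -[V [oV Vy] VB].
have [[_ ne0 capI _] _] := (svalP (b y)).1.
have [_ [z [Uz Vz]]] := ne0 _ (capI _ _ Uy (hb y V oV Vy)).
by exists z; split=> //; exact: VB.
Qed.

(** The operators [closure], [cb b] and [cl_theta] differ only in which set must meet [A]: [U],
    [hat b U] or [closure U]. Enlarging that set weakens the condition. *)
Lemma closure_sub_cb A : closure A `<=` cb b A.
Proof.
move=> x clAx U oU Ux.
have [y [Ay Uy]] := clAx U (open_nbhs_nbhs (conj oU Ux)).
by exists y; split=> //; exact: sub_hat.
Qed.

Lemma sub_cb A : A `<=` cb b A.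
Proof. exact: subset_trans (@subset_closure _ A) (closure_sub_cb A). Qed.

Lemma cbS A B : A `<=` B -> cb b A `<=` cb b B.
Proof. by move=> AB x cx U oU Ux; exact: subset_nonempty (setIS AB) (cx U oU Ux). Qed.

Lemma cb_sub_cl_theta A : cb b A `<=` cl_theta A.
Proof.
move=> x cx U oU Ux.
exact: subset_nonempty (setSI (hat_sub_closure U)) (cx U oU Ux).
Qed.

(** For the inclusion from right to left, a point of [U] in [hat b V] lies in [closure V]; as [U] is
    itself a neighbourhood of that point, [U] meets [V]. *)
Lemma closure_open_cb U : open U -> closure U = cb b U.
Proof.
move=> oU; apply/seteqP; split; first exact: closure_sub_cb.
move=> x cx B; rewrite nbhsE => -[V [oV Vx] VB].
have [y [Vy Uy]] := cx V oV Vx.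
have [z [Vz Uz]] := hat_sub_closure _ _ Vy U (open_nbhs_nbhs (conj oU Uy)).
by exists z; split=> //; exact: VB.
Qed.

End CbClosure.

(** By regularity every neighbourhood of [x] contains the closure of a smaller one, and that closure
    meets [A]. *)
Lemma regular_cl_theta_sub_closure (X : topologicalType) (A : set X) :
  regular_space X -> cl_theta A `<=` closure A.
Proof.
move=> rX x tx B /(rX x)[C nC clCB].
move: nC; rewrite nbhsE => -[V [oV Vx] VC].
have [y [Vy Ay]] := tx V oV Vx.
by exists y; split=> //; apply: clCB; exact: closureS VC _ Vy.
Qed.

Theorem proposition2p7 (X : topologicalType) (hX : hausdorff_space X)
    (b' : X -> EX X) (hb' : is_section b')
    (hmin : exists K : Type, is_aLb b' K /\ is_aL' X K)
    (A B : set X) :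
  (* (a) *) A `<=` cb b' A /\
  (* (b) *) (A `<=` B -> cb b' A `<=` cb b' B) /\
  (* (c) *) (closure A `<=` cb b' A /\ cb b' A `<=` cl_theta A) /\
  (* (d) *) (forall U : set X, open U ->
               closure U = cb b' U /\ cb b' U `<=` cb b' (hat b' U)) /\
  (* (e) *) (regular_space X -> closure A = cb b' A /\ cb b' A = cl_theta A) /\
  (* (f) *) (cb_closed b' A -> closed A).
Proof.
have clA : closure A `<=` cb b' A by exact: closure_sub_cb.
have cbA : cb b' A `<=` cl_theta A by exact: cb_sub_cl_theta.
split; first exact: sub_cb.
split; first exact: cbS.
split; first by [].
split.
  move=> U oU; split; first exact: closure_open_cb.
  by apply: cbS; exact: sub_hat.
(* For (f), [clA] becomes [closure A] included in [A], which is [closed A] by definition. *)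
split; last by move=> cA; rewrite /cb_closed in cA; rewrite cA in clA.
(* For (e), [thA] closes the chain [clA], [cbA] into a cycle of inclusions. *)
move=> rX; have thA := regular_cl_theta_sub_closure X A rX.
split; apply/seteqP; split=> //.
  exact: subset_trans cbA thA.
exact: subset_trans thA clA.
Qed.
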